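(* Let $R$ be a unitary ring, let $d\in R$ be regular, let $\overline{d}$ be a generalized inverse of $d$, and let $a\in R$. Then the following statements are equivalent. (i) $a$ is invertible along $d$. (ii) There exist unique $s,t\in R$ such that $a=\overline{d}s+t$, $s$ is group invertible, $p_s=1-d\overline{d}$ and $\overline{d}dtd\overline{d}=0$. In addition, in this case $a^{\parallel d}=s^\sharp d$. (iii) There exist unique $u,v\in R$ such that $a=u\overline{d}+v$, $u$ is group invertible, $p_u=1-\overline{d}d$ and $\overline{d}dvd\overline{d}=0$. Moreover, in this case $a^{\parallel d}=du^\sharp$. In particular, if $p\in R$ is an idempotent, then $a$ is invertible along $p$ if and only if there exist unique $s,t\in R$ such that $a=s+t$, $s$ is group invertible, $p_s=1-p$ and $ptp=0$. Furthermore, in this case $a^{\parallel p}=s^\sharp$.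
   Context: $R$ is an associative ring with unit $1$. An element $d$ is regular if there is $z\in R$ with $d=dzd$; any such $z$ is called a generalized (or inner) inverse of $d$. An element $a$ is invertible along $d$ if there is $b\in R$ with $b=bab$, $bR=dR$ and $Rb=Rd$; such $b$ is unique and is denoted $a^{\parallel d}$. An element $c\in R$ is group invertible if there is a (necessarily unique) $c^\sharp\in R$ with $cc^\sharp c=c$, $c^\sharp cc^\sharp=c^\sharp$, $cc^\sharp=c^\sharp c$; in that case $p_c:=1-c^\sharp c$. *)

(* Defs.v *)
From mathcomp Require Import all_boot all_algebra.

Set Implicit Arguments.
Unset Strict Implicit.
Unset Printing Implicit Defensive.

Import GRing.Theory.
Local Open Scope ring_scope.

Section Definitions.
Variable R : pzRingType.
Implicit Types a b c d g p s t u v x z : R.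

Definition inner_inverse d z : Prop := d = d * z * d.

Definition regular d : Prop := exists z, inner_inverse d z.

(* The principal one-sided ideals bR and Rb, as predicates on R. *)
Definition right_ideal_of b x : Prop := exists y, x = b * y.
Definition left_ideal_of b x : Prop := exists y, x = y * b.

(* [inverse_along a d b] is the graph of the partial operation a^{||d} = b;
   it is single-valued by [inverse_along_uniq]. *)
Definition inverse_along a d b : Prop :=
  [/\ b = b * a * b,
      forall x, right_ideal_of b x <-> right_ideal_of d x
    & forall x, left_ideal_of b x <-> left_ideal_of d x].

Definition invertible_along a d : Prop := exists b, inverse_along a d b.

(* [group_inverse c g] is the graph of the partial operation c^# = g;
   it is single-valued by [group_inverse_uniq]. *)
Definition group_inverse c g : Prop :=
  [/\ c * g * c = c, g * c * g = g & c * g = g * c].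

Definition group_invertible c : Prop := exists g, group_inverse c g.

(* The graph of the partial operation p_c = p, where p_c = 1 - c^# c. *)
Definition spectral_idempotent c p : Prop :=
  exists2 g, group_inverse c g & p = 1 - g * c.

Definition idempotent_elt p : Prop := p * p = p.

(* In the next two definitions z plays the role of the chosen inner inverse
   of d. *)
Definition left_decomposition a d z s t : Prop :=
  [/\ a = z * s + t, group_invertible s,
      spectral_idempotent s (1 - d * z) & z * d * t * d * z = 0].

Definition right_decomposition a d z u v : Prop :=
  [/\ a = u * z + v, group_invertible u,
      spectral_idempotent u (1 - z * d) & z * d * v * d * z = 0].

Definition idempotent_decomposition a p s t : Prop :=
  [/\ a = s + t, group_invertible s,
      spectral_idempotent s (1 - p) & p * t * p = 0].

Lemma group_inverse_uniq c g h :
  group_inverse c g -> group_inverse c h -> g = h.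
Proof.
move=> [cgc gcg cg] [chc hch ch].
have e : g * c = c * h by rewrite -{1}chc -mulrA -ch !mulrA -cg cgc.
by rewrite -gcg e ch -mulrA cg e mulrA hch.
Qed.

Lemma inverse_along_uniq a d b b' :
  inverse_along a d b -> inverse_along a d b' -> b = b'.
Proof.
move=> [bab bR Rb] [bab' bR' Rb'].
have [y yE] : right_ideal_of b' b by apply/bR'/bR; exists 1; rewrite mulr1.
have [w wE] : left_ideal_of b b' by apply/Rb/Rb'; exists 1; rewrite mul1r.
have e1 : b' * a * b = b by rewrite yE !mulrA -bab'.
have e2 : b' * a * b = b' by rewrite {1}wE -!mulrA (mulrA b) -bab -wE.
by rewrite -e1.
Qed.

End Definitions.

(* Main.v *)
Require Import Defs.
From mathcomp Require Import all_boot all_algebra.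

Import GRing.Theory.
Local Open Scope ring_scope.

(** Write [z] for the inner inverse of [d], so that [e = d * z] is an
idempotent with [e * d = d].  If [a = z * s + t] is a left
decomposition, then [s] lies in the corner [e R e] and, multiplying by [d] on
the left and by [e] on the right, [t] is annihilated: [d * a * d * z = s].  Hence the
only possible decomposition is [s = d * a * d * z], [t = a - z * s]
([left_decompositionP]), and uniqueness comes for free.  The existence of a
decomposition amounts to [d * a * d * z] being a unit of the corner [e R e].

This is the same thing as invertibility of [a] along [d]: from an inverse [b]
along [d] one gets the corner inverse [b * z]
([spectral_corner_of_inverse_along]), and from a corner inverse [g] one gets
the inverse [g * d] along [d] ([left_decomposition_inverse_along]).

A right decomposition is a left decomposition in the opposite ring, and
invertibility along an element is a left-right symmetric notion, so the
right-hand statements follow.  For an idempotent [p], seen as its own inner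
inverse, the left decomposition is the plain one because [s = p * s]
([idempotent_decompositionE]). *)

(** * The left decomposition *)

Section Left.
Context {R : pzRingType}.
Implicit Types a b d g p s t z : R.

(** Group invertibility with spectral idempotent [1 - e] says that [s] is a unit
of the corner [e R e]; since group inverses are unique, any given [g] is its
inverse there. *)
Lemma spectral_idempotentP {s g e} :
  spectral_idempotent s (1 - e) -> group_inverse s g ->
  [/\ s * g = e, g * s = e, e * s = s, s * e = s & e * g = g].
Proof.
move=> [h sh E] sg.
have hg : h = g by apply: group_inverse_uniq sh sg.
have gs : g * s = e.
  by apply: oppr_inj; apply: (addrI 1); rewrite -hg.
have [sgs gsg cgs] := sg.
by rewrite -gs; split=> //; [rewrite -cgs | rewrite mulrA].
Qed.

(** The decomposition leaves no choice: [s] is the compression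
[d * a * d * z] of [a], because [t] vanishes between [z * d] and [d * z]. *)
Lemma left_decompositionP {a d z s t} : inner_inverse d z ->
  left_decomposition a d z s t <->
  [/\ spectral_idempotent s (1 - d * z), s = d * a * d * z & t = a - z * s].
Proof.
move=> dzd; split.
- move=> [aE [g sg] ps t0]; split=> //; last by rewrite aE addrAC subrr add0r.
  have [_ _ es se _] := spectral_idempotentP ps sg.
  have dt0 : d * t * d * z = 0.
    (* [d * t * d * z] is [d] times the corner condition on [t]. *)
    by rewrite {1}dzd -!mulrA -(mulr0 d) -t0 -!mulrA.
  by rewrite aE mulrDr !mulrDl dt0 addr0 mulrA es -mulrA se.
- move=> [ps sE tE]; split=> //; first by rewrite tE addrC subrK.
    by case: ps => g sg _; exists g.
  (* [z * s] has the same compression as [a], by [d * z * d = d] used on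
     each side of [a]. *)
  rewrite tE mulrBr !mulrBl sE !mulrA.
  rewrite -(mulrA z d z) -(mulrA z (d * z) d) -dzd.
  rewrite -(mulrA (z * d * a) d z) -(mulrA (z * d * a) (d * z) d) -dzd.
  by rewrite mulrA subrr.
Qed.

(** The equality of ideals turns [b = b * a * b] into
[b * a * d = d = d * a * b], as for an ordinary inverse; so [b * z] inverts [d * a * d * z] in the corner of [d * z]. *)
Lemma spectral_corner_of_inverse_along {a d z b} : inner_inverse d z ->
  inverse_along a d b -> spectral_idempotent (d * a * d * z) (1 - d * z).
Proof.
move=> dzd [bab bR Rb].
have [x xE] : right_ideal_of d b by apply/bR; exists 1; rewrite mulr1.
have [w wE] : left_ideal_of d b by apply/Rb; exists 1; rewrite mul1r.
have [y yE] : right_ideal_of b d by apply/bR; exists 1; rewrite mulr1.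
have [v vE] : left_ideal_of b d by apply/Rb; exists 1; rewrite mul1r.
have bzd : b * z * d = b by rewrite {1}wE -!mulrA (mulrA d) -dzd -wE.
have dzb : d * z * b = b by rewrite xE mulrA -dzd.
have bad : b * a * d = d by rewrite {1}yE !mulrA -bab -yE.
have dab : d * a * b = d by rewrite {1}vE -!mulrA (mulrA b) -bab -vE.
have gs : b * z * (d * a * d * z) = d * z by rewrite !mulrA bzd bad.
have sg : d * a * d * z * (b * z) = d * z.
  by rewrite -!mulrA (mulrA z) (mulrA d (z * b)) (mulrA d z) dzb !mulrA dab.
exists (b * z); last by rewrite gs.
split; first by rewrite sg !mulrA -dzd.
  by rewrite gs mulrA dzb.
by rewrite gs sg.
Qed.

(** Since [g] lies in the corner of [d * z], one has
[d * a * (g * d) = s * g * d = d], and likewise [(g * d) * a * d = d].  These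
two absorption laws give the outer identity [b = b * a * b] for [b = g * d] and
the equality of ideals. *)
Lemma left_decomposition_inverse_along {a d z s t g} : inner_inverse d z ->
  left_decomposition a d z s t -> group_inverse s g ->
  inverse_along a d (g * d).
Proof.
move=> dzd /(left_decompositionP dzd)[ps sE _] sg.
have [sgE gsE _ _ eg] := spectral_idempotentP ps sg.
have dagd : d * a * (g * d) = d.
  by rewrite -{1}eg !mulrA -sE sgE -dzd.
have gdad : g * d * a * d = d.
  by rewrite [in RHS]dzd -gsE sE !mulrA -(mulrA _ d z) -(mulrA (g * d * a)) -dzd.
split; first by rewrite -!mulrA (mulrA d) dagd.
- move=> x; split=> -[y ->].
    by exists (z * g * d * y); rewrite !mulrA eg.
  by exists (a * d * y); rewrite !mulrA gdad.
- move=> x; split=> -[y ->]; first by exists (y * g); rewrite mulrA.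
  by exists (y * s); rewrite -mulrA (mulrA s) sgE -dzd.
Qed.

Lemma invertible_along_iff_left {a d z} : inner_inverse d z ->
  invertible_along a d <->
  exists! st : R * R, left_decomposition a d z st.1 st.2.
Proof.
move=> dzd; split=> [[b ab]|[[s t] /= [dec _]]].
- pose s := d * a * d * z; exists (s, a - z * s); split=> /=.
    apply/(left_decompositionP dzd); split=> //.
    exact: spectral_corner_of_inverse_along dzd ab.
  by move=> [s' t'] /= /(left_decompositionP dzd)[_ -> ->].
- have [_ [g sg] _ _] := dec.
  by exists (g * d); apply: left_decomposition_inverse_along dzd dec sg.
Qed.

End Left.

(** * Passing to the opposite ring *)

Section Opposite.
Context {R : pzRingType}.
Implicit Types a b c d g p u v z : R.

Lemma inner_inverse_opp d z :
  inner_inverse d z -> inner_inverse (d : R^c) (z : R^c).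
Proof. by rewrite /inner_inverse /= => {1}->; rewrite -mulrA. Qed.

Lemma inverse_along_opp a d b :
  inverse_along a d b <-> inverse_along (a : R^c) (d : R^c) (b : R^c).
Proof.
by split=> -[bab bR Rb]; split=> //; rewrite [LHS]bab -[LHS]mulrA.
Qed.

Lemma invertible_along_opp a d :
  invertible_along a d <-> invertible_along (a : R^c) (d : R^c).
Proof. by split=> -[b /inverse_along_opp ab]; exists b. Qed.

Lemma group_inverse_opp c g :
  group_inverse c g <-> group_inverse (c : R^c) (g : R^c).
Proof.
split=> -[cgc gcg cg]; split; rewrite -?[RHS]cg //.
- by rewrite -[RHS]cgc -[RHS]mulrA.
- by rewrite -[RHS]gcg -[RHS]mulrA.
- by rewrite -[RHS]cgc -[LHS]mulrA.
- by rewrite -[RHS]gcg -[LHS]mulrA.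
Qed.

Lemma group_invertible_opp c :
  group_invertible c <-> group_invertible (c : R^c).
Proof. by split=> -[g /group_inverse_opp cg]; exists g. Qed.

(** The formula [1 - g * c] becomes [1 - c * g] in the opposite ring; the two
agree because a group inverse commutes with its element. *)
Lemma spectral_idempotent_opp c p :
  spectral_idempotent c p <-> spectral_idempotent (c : R^c) (p : R^c).
Proof.
split=> -[g cg ->]; exists g; try exact/group_inverse_opp.
  by have [_ _ e] := cg; congr (1 - _); rewrite -[LHS]e.
by have [_ _ e] := cg; congr (1 - _); rewrite -[LHS]e.
Qed.

Lemma right_decomposition_opp a d z u v :
  right_decomposition a d z u v <->
  left_decomposition (a : R^c) (d : R^c) (z : R^c) (u : R^c) (v : R^c).
Proof.
have zE : z * d * v * d * z = z * (d * (v * (d * z))) by rewrite !mulrA.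
split=> -[aE /group_invertible_opp gu /spectral_idempotent_opp pu v0].
  by split; [exact: aE | exact: gu | exact: pu | rewrite -[LHS]zE].
by split; [exact: aE | exact: gu | exact: pu | rewrite zE; exact: v0].
Qed.

End Opposite.

Section Right.
Context {R : pzRingType}.
Implicit Types a d g u v z : R.

Lemma right_decomposition_inverse_along {a d z u v g} : inner_inverse d z ->
  right_decomposition a d z u v -> group_inverse u g ->
  inverse_along a d (d * g).
Proof.
move=> /inner_inverse_opp dzd /right_decomposition_opp dec.
move=> /group_inverse_opp ug; apply/inverse_along_opp.
exact: left_decomposition_inverse_along dzd dec ug.
Qed.

Lemma invertible_along_iff_right {a d z} : inner_inverse d z ->
  invertible_along a d <->
  exists! uv : R * R, right_decomposition a d z uv.1 uv.2.
Proof.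
move=> /inner_inverse_opp dzd.
apply: iff_trans (invertible_along_opp a d) _.
apply: iff_trans (invertible_along_iff_left dzd) _.
by split=> -[uv [/right_decomposition_opp dec uniq]]; exists uv; split=> // w;
  move=> /right_decomposition_opp; apply: uniq.
Qed.

End Right.

(** * Idempotents *)

Section Idempotent.
Context {R : pzRingType}.
Implicit Types a p s t : R.

(** The condition on the spectral idempotent puts [s] in the corner of [p], so
the factor [p] in [a = p * s + t] is invisible. *)
Lemma idempotent_decompositionE {a p s t} : idempotent_elt p ->
  idempotent_decomposition a p s t <-> left_decomposition a p p s t.
Proof.
move=> pp; rewrite /left_decomposition pp -(mulrA _ p p) pp.
split=> -[aE [g sg] ps t0]; have [_ _ es _ _] := spectral_idempotentP ps sg;
  by split=> //; [rewrite ?es // -[in RHS]es | exists g].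
Qed.

End Idempotent.

(** * Invertibility along a regular element *)

Theorem theorem5p3 (R : pzRingType) :
  (forall d dbar a : R, regular d -> inner_inverse d dbar ->
     [/\ [<-> invertible_along a d;
              exists! st : R * R, left_decomposition a d dbar st.1 st.2;
              exists! uv : R * R, right_decomposition a d dbar uv.1 uv.2],
         forall s t sg : R, left_decomposition a d dbar s t ->
           group_inverse s sg -> inverse_along a d (sg * d)
       & forall u v ug : R, right_decomposition a d dbar u v ->
           group_inverse u ug -> inverse_along a d (d * ug)]) /\
  (forall p a : R, idempotent_elt p ->
     (invertible_along a p <->
        exists! st : R * R, idempotent_decomposition a p st.1 st.2) /\
     (forall s t sg : R, idempotent_decomposition a p s t ->
        group_inverse s sg -> inverse_along a p sg)).
Proof.
split=> [d z a _ dzd|p a pp].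
  split; last 2 first.
  - by move=> s t g; apply: left_decomposition_inverse_along.
  - by move=> u v g; apply: right_decomposition_inverse_along.
  tfae=> [/(invertible_along_iff_left dzd) //
         |/(invertible_along_iff_left dzd) ai
         |/(invertible_along_iff_right dzd) //].
  by apply/(invertible_along_iff_right dzd).
have ppp : inner_inverse p p by rewrite /inner_inverse !pp.
split=> [|s t g /[dup] [[_ _ ps _]] dec sg].
  apply: iff_trans (invertible_along_iff_left ppp) _.
  by split=> -[st [/(idempotent_decompositionE pp) dec uniq]]; exists st;
    split=> // w /(idempotent_decompositionE pp); apply: uniq.
(* The formula for [d = p] gives [g * p], and [p] is the unit of the corner
   containing [g]. *)
have [sgE _ _ _ _] := spectral_idempotentP ps sg.
have -> : g = g * p by have [_ gsg _] := sg; rewrite -sgE mulrA gsg.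
by apply: left_decomposition_inverse_along ppp _ sg;
  apply/(idempotent_decompositionE pp); exact: dec.
Qed.
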